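(* Let $X$ be a connected topological manifold of dimension at least two, let $\Gamma$ be a simple graph without loops on the vertex set $[n]=\{1,\dots,n\}$, and let ${\bf x}=(x_1,\dots,x_n)\in F(X,\Gamma)$ be a base point whose coordinates $x_i$ are pairwise distinct. Then the crossing-changeable braid group $B(X,\Gamma)$ is isomorphic to the extended fundamental group $\pi_1^E(F(X,\Gamma),{\bf x},\mathrm{Aut}(\Gamma)({\bf x}))$.
   Context: Let $E(\Gamma)$ be the edge set of $\Gamma$ and $\overline{jk}$ the edge joining $j,k$. The chromatic configuration space is $F(X,\Gamma)=\{(x_1,\dots,x_n)\in X^{\times n}\mid x_j\neq x_k \text{ for } \overline{jk}\in E(\Gamma)\}$ with the subspace topology. $\mathrm{Aut}(\Gamma)=\{\sigma\in\Sigma_n\mid \overline{\sigma(j)\sigma(k)}\in E(\Gamma)\iff\overline{jk}\in E(\Gamma)\}$ acts on $F(X,\Gamma)$ by $(\sigma,(x_1,\dots,x_n))\mapsto(x_{\sigma(1)},\dots,x_{\sigma(n)})$ (products of permutations are read left to right: $(\sigma\tau)(i)=\tau(\sigma(i))$). Write ${\bf x}_\sigma=(x_{\sigma(1)},\dots,x_{\sigma(n)})$, and for a path $\alpha=(\alpha_1,\dots,\alpha_n):I=[0,1]\to F(X,\Gamma)$ write $\alpha_\sigma=(\alpha_{\sigma(1)},\dots,\alpha_{\sigma(n)})$. $\mathrm{Aut}(\Gamma)({\bf x})$ is the orbit of ${\bf x}$. Let $P(F(X,\Gamma),{\bf x},\mathrm{Aut}(\Gamma)({\bf x}))$ be the set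 of paths $\alpha:I\to F(X,\Gamma)$ with $\alpha(0)={\bf x}$ and $\alpha(1)\in\mathrm{Aut}(\Gamma)({\bf x})$. For such $\alpha$, the crossing-changeable braid $c(\alpha)=\{c(\alpha_1),\dots,c(\alpha_n)\}$ is the (unordered) collection of $n$ strings $c(\alpha_i)=\{(\alpha_i(s),s)\mid s\in I\}$ in $X\times I$. Equivalence: $c(\alpha)\sim c(\beta)$ if there are $n$ continuous maps $\widehat{h_i}:I\times I\to X\times I$, $\widehat{h_i}(s,t)=(h_i(s,t),s)$, $i=1,\dots,n$, such that (1) $\widehat{h_i}(\cdot,0)$ is the string $c(\alpha_i)$ and $\widehat{h_i}(\cdot,1)$ is the string $c(\beta_i)$, i.e. $h_i(s,0)=\alpha_i(s)$, $h_i(s,1)=\beta_i(s)$; (2) $h_i(0,t)=\alpha_i(0)=\beta_i(0)$ and $h_i(1,t)=\alpha_i(1)=\beta_i(1)$; (3) for all $(s,t)\in I\times I$, if $\overline{jk}\in E(\Gamma)$ then $h_j(s,t)\neq h_k(s,t)$. $B(X,\Gamma)$ is the set of equivalence classes $[c(\alpha)]$, $\alpha\in P(F(X,\Gamma),{\bf x},\mathrm{Aut}(\Gamma)({\bf x}))$, with operation $[c(\alpha)]\star[c(\beta)]=[c(\alpha\circ\beta_\sigma)]$ where $\alpha(1)={\bf x}_\sigma$ and $\circ$ is concatenation of paths (first $\alpha$, then $\beta_\sigma$). The extended fundamental group $\pi_1^E(F(X,\Gamma),{\bf x},\mathrm{Aut}(\Gamma)({\bf x}))$ is the set of homotopy classes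 rel $\partial I$ of paths in $P(F(X,\Gamma),{\bf x},\mathrm{Aut}(\Gamma)({\bf x}))$, with operation $[\alpha]\bullet[\beta]=[\alpha\circ\beta_\sigma]$ where $\alpha(1)={\bf x}_\sigma$. *)

(* Defs.v *)
From HB Require Import structures.
From mathcomp Require Import all_boot all_order all_algebra all_fingroup.
From mathcomp Require Import generic_quotient lra.
From mathcomp Require Import all_classical all_reals topology normedtype.

Set Implicit Arguments.
Unset Strict Implicit.
Unset Printing Implicit Defensive.

Import Order.TTheory GRing.Theory Num.Theory.
Import numFieldNormedType.Exports.

Local Open Scope classical_set_scope.
Local Open Scope ring_scope.
Local Open Scope quotient_scope.

Definition homeomorphic (S T : topologicalType) : Prop :=
  exists (f : S -> T) (g : T -> S),
    [/\ continuous f, continuous g, cancel f g & cancel g f].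

Definition locally_euclidean (R : realType) (d : nat) (X : topologicalType) :=
  forall p : X, exists (U : set X) (V : set 'rV[R]_d),
    [/\ open U, U p, open V & homeomorphic (set_type U) (set_type V)].

(* Topological manifolds are without boundary. *)
Definition topological_manifold (R : realType) (d : nat)
    (X : topologicalType) : Prop :=
  [/\ hausdorff_space X, @second_countable X & locally_euclidean R d X].

Record sgraph (n : nat) := SGraph {
  edge :> rel 'I_n;
  edge_sym : symmetric edge;
  edge_irr : irreflexive edge }.

Section GraphAut.
Variables (n : nat) (G : sgraph n).

Definition graph_aut : {set 'S_n} :=
  [set s : 'S_n | [forall j, forall k, G (s j) (s k) == G j k]].

Lemma graph_autP (s : 'S_n) :
  reflect (forall j k, G (s j) (s k) = G j k) (s \in graph_aut).
Proof.
rewrite inE; apply: (iffP forallP) => [h j k | h j].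
  by move/forallP: (h j) => /(_ k)/eqP.
by apply/forallP => k; rewrite h.
Qed.

Lemma graph_aut_group_set : group_set graph_aut.
Proof.
apply/group_setP; split=> [|s t].
  by apply/graph_autP => j k; rewrite !perm1.
move=> /graph_autP hs /graph_autP ht.
by apply/graph_autP => j k; rewrite !permM ht hs.
Qed.

Canonical graph_aut_group := Group graph_aut_group_set.

End GraphAut.

Section ConfigurationSpace.
Variables (X : topologicalType) (n : nat) (G : sgraph n).

(* The chromatic configuration space F(X,G), a subspace of the product X^n. *)
Definition config : set {ptws 'I_n -> X} :=
  [set y | forall j k, G j k -> y j <> y k].

Definition ccoord (i : 'I_n) (y : config) : X := set_val y i.

Lemma coordP (y : config) j k : G j k -> ccoord j y <> ccoord k y.
Proof. by case: y => y /= h; rewrite /ccoord; move: (set_mem h); exact. Qed.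

Lemma config_eqP (y z : config) : (forall i, ccoord i y = ccoord i z) -> y = z.
Proof. by move=> h; apply: val_inj; apply/funext. Qed.

Definition mk_config (y : 'I_n -> X) (h : forall j k, G j k -> y j <> y k) :
  config := @exist _ _ (y : {ptws 'I_n -> X}) (mem_set h).

Lemma cact_subproof (s : subg_of (graph_aut_group G)) (y : config) j k :
  G j k -> ccoord (sgval s j) y <> ccoord (sgval s k) y.
Proof.
move=> Gjk; apply: coordP.
by have /graph_autP -> := subgP s.
Qed.

(* cact s y is y_s = (y_{s(1)}, ..., y_{s(n)}).  The product of perm.v is
   read left to right, (s * t) i = t (s i), so that this is a left action:
   see cactM. *)
Definition cact (s : subg_of (graph_aut_group G)) (y : config) : config :=
  mk_config (@cact_subproof s y).

Definition aut_orbit (y : config) : set config := range (cact^~ y).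

Lemma coord_cact s i y : ccoord i (cact s y) = ccoord (sgval s i) y.
Proof. by []. Qed.

Lemma cact1 y : cact 1%g y = y.
Proof. by apply: config_eqP => i; rewrite coord_cact /= perm1. Qed.

Lemma cactM s t y : cact (s * t)%g y = cact s (cact t y).
Proof. by apply: config_eqP => i; rewrite !coord_cact /= permM. Qed.

Lemma coord_continuous i : continuous (ccoord i).
Proof.
have -> : ccoord i = (fun y : {ptws 'I_n -> X} => y i) \o set_val by [].
move=> y; apply: continuous_comp; first exact: initial_continuous.
exact: (@proj_continuous 'I_n (fun=> X) i).
Qed.

Lemma config_continuous (Z : topologicalType) (f : Z -> config) :
  (forall i, continuous (ccoord i \o f)) -> continuous f.
Proof.
move=> cf; apply: (@continuous_comp_initial _ _ _ set_val f) => z.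
apply/cvg_sup => i; move: z.
have h := @continuous_comp_initial _ Z X (fun y => y i) (set_val \o f) (cf i).
by move=> z; exact: h.
Qed.

Lemma cact_continuous s : continuous (cact s).
Proof.
by apply: config_continuous => i y; exact: (@coord_continuous (sgval s i)).
Qed.

End ConfigurationSpace.

Arguments config X {n} G.

Section UnitInterval.
Variable R : realType.

Definition unit_itv : set R := `[0, 1].
Local Notation I := (set_type unit_itv).

Lemma unit_itv_inj : injective (set_val : I -> R).
Proof. by move=> s t; rewrite set_valE; exact: val_inj. Qed.

Lemma unit_itvP (s : I) : 0 <= set_val s <= 1.
Proof. by case: s => s /= h; move: (set_mem h); rewrite /unit_itv /= in_itv. Qed.

Lemma clamp_subproof (r : R) : Num.max 0 (Num.min 1 r) \in unit_itv.
Proof.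
apply/mem_set; rewrite /unit_itv /= in_itv /= le_max lexx /=.
by rewrite ge_max ler01 ge_min lexx.
Qed.

Definition clamp (r : R) : I :=
  exist (fun y => y \in unit_itv) _ (clamp_subproof r).

Lemma val_clamp r : set_val (clamp r) = Num.max 0 (Num.min 1 r).
Proof. by []. Qed.

Lemma clampE r : 0 <= r <= 1 -> set_val (clamp r) = r.
Proof.
by move=> /andP[r0 r1]; rewrite val_clamp (min_idPr r1) (max_idPr r0).
Qed.

Lemma clamp_ge1 r : 1 <= r -> clamp r = clamp 1.
Proof.
by move=> h; apply: unit_itv_inj; rewrite !val_clamp (min_idPl h) minxx.
Qed.

Lemma clamp_le0 r : r <= 0 -> clamp r = clamp 0.
Proof.
move=> h; apply: unit_itv_inj; rewrite !val_clamp.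
by rewrite (min_idPr (le_trans h ler01)) (max_idPl h) (min_idPr ler01) maxxx.
Qed.

Lemma clampK (s : I) : clamp (set_val s) = s.
Proof. by apply: unit_itv_inj; apply: clampE; exact: unit_itvP. Qed.

Lemma val_continuous : continuous (set_val : I -> R).
Proof. exact: initial_continuous. Qed.

Lemma clamp_continuous : continuous clamp.
Proof.
apply: (@continuous_comp_initial _ _ _ (set_val : I -> R)) => r /=.
apply: (@continuous_max R R (cst 0) (fun r => Num.min 1 r)).
  exact: cvg_cst.
by apply: (@continuous_min R R (cst 1) id); [exact: cvg_cst | exact: cvg_id].
Qed.

Definition I0 : I := clamp 0.
Definition I1 : I := clamp 1.

Lemma val_I0 : set_val I0 = 0.
Proof. by rewrite clampE ?lexx ?ler01. Qed.

Lemma val_I1 : set_val I1 = 1.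
Proof. by rewrite clampE ?lexx ?ler01. Qed.

Section Paths.
Variable T : topologicalType.

(* First a, then b. *)
Definition concat (a b : I -> T) : I -> T := fun s =>
  if set_val s <= 2^-1 then a (clamp (2 * set_val s))
  else b (clamp (2 * set_val s - 1)).

(* H is a homotopy from a to b relative to the boundary of [0, 1]; the first
   variable is the parameter of the paths. *)
Definition homotopy_rel (a b : I -> T) (H : I * I -> T) : Prop :=
  [/\ continuous H,
      forall s, H (s, I0) = a s,
      forall s, H (s, I1) = b s,
      forall t, H (I0, t) = a I0 /\ H (I0, t) = b I0 &
      forall t, H (I1, t) = a I1 /\ H (I1, t) = b I1].

Lemma paste_continuous (Z : topologicalType) (u : Z -> R) (f g : Z -> T) c :
  continuous u -> continuous f -> continuous g ->
  (forall z, u z = c -> f z = g z) ->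
  continuous (fun z => if u z <= c then f z else g z).
Proof.
move=> cu cf cg fg.
set k := fun z => _.
have cA : closed [set z | u z <= c].
  exact: (@closed_comp _ _ u [set r | r <= c]) (in1W cu) (@closed_le R c).
have cB : closed [set z | c <= u z].
  exact: (@closed_comp _ _ u [set r | c <= r]) (in1W cu) (@closed_ge R c).
have : {within [set z | u z <= c] `|` [set z | c <= u z], continuous k}.
  apply: withinU_continuous => //.
    apply: (@subspace_eq_continuous _ _ _ f); last exact: continuous_subspaceT.
    by move=> z /set_mem /= uz; rewrite /from_subspace /k/= uz.
  apply: (@subspace_eq_continuous _ _ _ g); last exact: continuous_subspaceT.
  move=> z /set_mem /= uz; rewrite /from_subspace /k/=; case: ifPn => // uz'.
  by rewrite fg//; apply/eqP; rewrite eq_le uz uz'.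
have -> : [set z | u z <= c] `|` [set z | c <= u z] = setT.
  rewrite -subTset => z _ /=.
  by case: (leP (u z) c) => h; [left | right; exact: ltW].
exact: (continuous_subspace_setT k).2.
Qed.

End Paths.

Lemma affine_continuous (Z : topologicalType) (u : Z -> R) (k l : R) :
  continuous u -> continuous (fun z => clamp (k * u z + l)).
Proof.
move=> cu z; apply: (@continuous_comp _ _ _ (fun z => k * u z + l) clamp).
  by apply: cvgD; [apply: cvgM; [exact: cvg_cst|exact: cu] | exact: cvg_cst].
exact: clamp_continuous.
Qed.

Lemma half_clamp0 : clamp (2 * 2^-1 - 1) = I0.
Proof. by rewrite divff ?pnatr_eq0// subrr. Qed.

Lemma half_clamp1 : clamp (2 * 2^-1) = I1.
Proof. by rewrite divff ?pnatr_eq0. Qed.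

Section Homotopies.
Variable T : topologicalType.
Implicit Types a b : I -> T.

Lemma concat0 a b : concat a b I0 = a I0.
Proof. by rewrite /concat val_I0 invr_ge0 ler0n mulr0. Qed.

Lemma concat1 a b : concat a b I1 = b I1.
Proof.
rewrite /concat val_I1 leNgt invf_lt1 ?ltr0n// ltr1n /= mulr1.
by rewrite (natrD _ 1 1) addrK.
Qed.

Lemma comp_continuous (Y Z W : topologicalType) (f : Y -> Z) (g : Z -> W) :
  continuous f -> continuous g -> continuous (g \o f).
Proof. by move=> cf cg y; apply: continuous_comp; [exact: cf|exact: cg]. Qed.

Lemma pair_continuous (Y Z W : topologicalType) (f : Y -> Z) (g : Y -> W) :
  continuous f -> continuous g -> continuous (fun y => (f y, g y)).
Proof. by move=> cf cg y; apply: cvg_pair; [exact: cf|exact: cg]. Qed.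

Let id_cont (Z : topologicalType) : continuous (@id Z).
Proof. by move=> z; exact: cvg_id. Qed.

Let fst_cont (Y Z : topologicalType) : continuous (@fst Y Z).
Proof. by move=> z; exact: cvg_fst. Qed.

Let snd_cont (Y Z : topologicalType) : continuous (@snd Y Z).
Proof. by move=> z; exact: cvg_snd. Qed.

Let dbl_continuous (Z : topologicalType) (u : Z -> I) : continuous u ->
  continuous (fun z => clamp (2 * set_val (u z))).
Proof.
move=> cu; have -> : (fun z => clamp (2 * set_val (u z))) =
    (fun z => clamp (2 * set_val (u z) + 0)).
  by apply/funext => z; rewrite addr0.
by apply: affine_continuous; exact: comp_continuous cu val_continuous.
Qed.

Let dbl1_continuous (Z : topologicalType) (u : Z -> I) : continuous u ->
  continuous (fun z => clamp (2 * set_val (u z) - 1)).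
Proof.
move=> cu; apply: affine_continuous; exact: comp_continuous cu val_continuous.
Qed.

Lemma concat_continuous a b : continuous a -> continuous b -> a I1 = b I0 ->
  continuous (concat a b).
Proof.
move=> ca cb ab; apply: paste_continuous.
- exact: val_continuous.
- exact (comp_continuous (dbl_continuous (@id_cont _)) ca).
- exact (comp_continuous (dbl1_continuous (@id_cont _)) cb).
- by move=> s ->; rewrite half_clamp0 half_clamp1.
Qed.

Lemma homotopy_rel_refl a : continuous a -> homotopy_rel a a (a \o fst).
Proof.
move=> ca; split=> //.
by apply: comp_continuous ca; exact: fst_cont.
Qed.

Definition rev_itv (s : I) : I := clamp (1 - set_val s).

Lemma rev_itv_continuous : continuous rev_itv.
Proof.
have -> : rev_itv = (fun s => clamp (-1 * set_val s + 1)).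
  by apply/funext => s; rewrite mulN1r addrC.
by apply: affine_continuous; exact: val_continuous.
Qed.

Lemma rev_itv0 : rev_itv I0 = I1.
Proof. by rewrite /rev_itv val_I0 subr0. Qed.

Lemma rev_itv1 : rev_itv I1 = I0.
Proof. by rewrite /rev_itv val_I1 subrr. Qed.

Lemma homotopy_rel_sym a b H : homotopy_rel a b H ->
  homotopy_rel b a (fun z => H (z.1, rev_itv z.2)).
Proof.
move=> [cH Ha Hb H0 H1]; split=> /=.
- apply: (@comp_continuous _ _ _ (fun z => (z.1, rev_itv z.2)) H) cH.
  apply: pair_continuous; first exact: fst_cont.
  by apply: comp_continuous rev_itv_continuous; exact: snd_cont.
- by move=> s; rewrite rev_itv0.
- by move=> s; rewrite rev_itv1.
- by move=> t; have [] := H0 (rev_itv t).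
- by move=> t; have [] := H1 (rev_itv t).
Qed.

Definition vpaste (H K : I * I -> T) : I * I -> T :=
  fun z => concat (fun t => H (z.1, t)) (fun t => K (z.1, t)) z.2.

Lemma homotopy_rel_trans a b c H K :
  homotopy_rel a b H -> homotopy_rel b c K -> homotopy_rel a c (vpaste H K).
Proof.
move=> [cH Ha Hb H0 H1] [cK Ka Kb K0 K1]; split=> /=.
- apply: (@paste_continuous _ _ (fun z : I * I => set_val z.2)
    (fun z => H (z.1, clamp (2 * set_val z.2)))
    (fun z => K (z.1, clamp (2 * set_val z.2 - 1)))).
  + by apply: comp_continuous val_continuous; exact: snd_cont.
  + apply: comp_continuous cH; apply: pair_continuous.
      exact: fst_cont.
    by apply: dbl_continuous; exact: snd_cont.
  + apply: comp_continuous cK; apply: pair_continuous.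
      exact: fst_cont.
    by apply: dbl1_continuous; exact: snd_cont.
  + by move=> z ->; rewrite half_clamp0 half_clamp1 Hb Ka.
- by move=> s; rewrite /vpaste concat0 Ha.
- by move=> s; rewrite /vpaste concat1 Kb.
- have ab : a I0 = b I0 by have [<- <-] := H0 I0.
  have bc : b I0 = c I0 by have [<- <-] := K0 I0.
  move=> t; rewrite /vpaste /concat /= -bc -ab.
  by case: ifP => _; [have [->] := H0 (clamp (2 * set_val t)) |
    have [-> _] := K0 (clamp (2 * set_val t - 1))].
- have ab : a I1 = b I1 by have [<- <-] := H1 I0.
  have bc : b I1 = c I1 by have [<- <-] := K1 I0.
  move=> t; rewrite /vpaste /concat /= -bc -ab.
  by case: ifP => _; [have [->] := H1 (clamp (2 * set_val t)) |
    have [-> _] := K1 (clamp (2 * set_val t - 1))].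
Qed.

Definition hpaste (H K : I * I -> T) : I * I -> T :=
  fun z => concat (fun s => H (s, z.2)) (fun s => K (s, z.2)) z.1.

Lemma homotopy_rel_concat a b c d H K : a I1 = c I0 ->
  homotopy_rel a b H -> homotopy_rel c d K ->
  homotopy_rel (concat a c) (concat b d) (hpaste H K).
Proof.
move=> ac [cH Ha Hb H0 H1] [cK Ka Kb K0 K1]; split=> /=.
- apply: (@paste_continuous _ _ (fun z : I * I => set_val z.1)
    (fun z => H (clamp (2 * set_val z.1), z.2))
    (fun z => K (clamp (2 * set_val z.1 - 1), z.2))).
  + by apply: comp_continuous val_continuous; exact: fst_cont.
  + apply: comp_continuous cH; apply: pair_continuous.
      by apply: dbl_continuous; exact: fst_cont.
    exact: snd_cont.
  + apply: comp_continuous cK; apply: pair_continuous.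
      by apply: dbl1_continuous; exact: fst_cont.
    exact: snd_cont.
  + move=> z ->; rewrite half_clamp0 half_clamp1.
    by have [-> _] := H1 z.2; have [-> _] := K0 z.2.
- by move=> s; rewrite /hpaste /concat /= Ha Ka.
- by move=> s; rewrite /hpaste /concat /= Hb Kb.
- by move=> t; rewrite /hpaste !concat0; exact: H0.
- by move=> t; rewrite /hpaste !concat1; exact: K1.
Qed.

Definition interp (f g : I -> I) : I * I -> I := fun z =>
  clamp ((1 - set_val z.2) * set_val (f z.1) + set_val z.2 * set_val (g z.1)).

Lemma homotopy_rel_reparam (p : I -> T) (f g : I -> I) :
  continuous p -> continuous f -> continuous g ->
  f I0 = g I0 -> f I1 = g I1 ->
  homotopy_rel (p \o f) (p \o g) (p \o interp f g).
Proof.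
move=> cp cf cg fg0 fg1.
have same s t : f s = g s -> interp f g (s, t) = f s.
  by move=> e; rewrite /interp /= -e -mulrDl subrK mul1r clampK.
split=> /=.
- apply: comp_continuous cp; apply: comp_continuous clamp_continuous => z.
  have c2 := comp_continuous (@snd_cont I I) val_continuous.
  apply: cvgD; apply: cvgM.
  + by apply: cvgB; [exact: cvg_cst|exact: c2].
  + exact: (comp_continuous (comp_continuous (@fst_cont I I) cf) val_continuous).
  + exact: c2.
  + exact: (comp_continuous (comp_continuous (@fst_cont I I) cg) val_continuous).
- by move=> s; rewrite /interp /= val_I0 subr0 mul1r mul0r addr0 clampK.
- by move=> s; rewrite /interp /= val_I1 subrr mul1r mul0r add0r clampK.
- by move=> t; rewrite same// -fg0.
- by move=> t; rewrite same// -fg1.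
Qed.

End Homotopies.

End UnitInterval.

Arguments unit_itv R : clear implicits.
Arguments I0 R : clear implicits.
Arguments I1 R : clear implicits.

Section OrbitPaths.
Variables (R : realType) (X : topologicalType) (n : nat) (G : sgraph n).
Variable x : config X G.
Local Notation I := (set_type (unit_itv R)).
Local Notation F := (set_type (config X G)).
Local Notation Aut := (subg_of (graph_aut_group G)).

(* P(F(X,G), x, Aut(G)(x)) *)
Record orbit_path := OrbitPath {
  path_fun :> I -> F;
  path_cont : continuous path_fun;
  path_start : path_fun (I0 R) = x;
  path_stop : aut_orbit x (path_fun (I1 R)) }.

HB.instance Definition _ := gen_eqMixin orbit_path.
HB.instance Definition _ := gen_choiceMixin orbit_path.

Local Notation P := orbit_path.

Lemma orbit_path_inj : injective path_fun.
Proof.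
move=> [a ca a0 a1] [b cb b0 b1] /= ab; case: _ / ab in cb b0 b1 *.
by congr OrbitPath; exact: Prop_irrelevance.
Qed.

Lemma path_end_subproof (a : P) : exists s : Aut, a (I1 R) = cact s x.
Proof. by have [s _ <-] := path_stop a; exists s. Qed.

Definition path_end (a : P) : Aut := projT1 (cid (path_end_subproof a)).

Lemma path_endP (a : P) : a (I1 R) = cact (path_end a) x.
Proof. exact: projT2 (cid (path_end_subproof a)). Qed.

Definition mk_path (a : I -> F) (s : Aut) (ca : continuous a)
    (a0 : a (I0 R) = x) (a1 : a (I1 R) = cact s x) : P :=
  OrbitPath ca a0 (ex_intro2 _ _ s Logic.I (esym a1)).

Lemma path_mul_cont (a b : P) (s : Aut) : a (I1 R) = cact s x ->
  continuous (concat a (cact s \o b)).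
Proof.
move=> a1; apply: concat_continuous; first exact: path_cont.
  move=> t; apply: continuous_comp; first exact: path_cont.
  exact: cact_continuous.
by rewrite a1 /= path_start.
Qed.

Lemma path_mul0 (a b : P) (s : Aut) : concat a (cact s \o b) (I0 R) = x.
Proof. by rewrite concat0 path_start. Qed.

Lemma path_mul1 (a b : P) (s : Aut) :
  concat a (cact s \o b) (I1 R) = cact (s * path_end b)%g x.
Proof. by rewrite concat1 /= path_endP cactM. Qed.

(* The path a o b_s, where a(1) = x_s.  The s is unique as soon as the
   coordinates of x are pairwise distinct: see path_mulE. *)
Definition path_mul (a b : P) : P :=
  mk_path (@path_mul_cont a b _ (path_endP a)) (path_mul0 a b (path_end a))
    (path_mul1 a b (path_end a)).

Lemma path_one_cont : continuous (fun _ : I => x).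
Proof. exact: cst_continuous. Qed.

Definition path_one : P :=
  mk_path path_one_cont (erefl x) (esym (cact1 x)).

Lemma path_inv_cont (a : P) :
  continuous (fun s => cact (path_end a)^-1%g (a (rev_itv s))).
Proof.
move=> s; apply: continuous_comp; last exact: cact_continuous.
apply: continuous_comp; first exact: rev_itv_continuous.
exact: path_cont.
Qed.

Lemma path_inv0 (a : P) : cact (path_end a)^-1%g (a (rev_itv (I0 R))) = x.
Proof. by rewrite rev_itv0 path_endP -cactM mulVg cact1. Qed.

Lemma path_inv1 (a : P) :
  cact (path_end a)^-1%g (a (rev_itv (I1 R))) = cact (path_end a)^-1%g x.
Proof. by rewrite rev_itv1 path_start. Qed.

Definition path_inv (a : P) : P :=
  mk_path (@path_inv_cont a) (path_inv0 a) (path_inv1 a).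

Hypothesis xI : injective (fun i => ccoord i x).

Lemma cact_inj : injective (fun s : Aut => cact s x).
Proof.
move=> s t st; apply: val_inj; apply/permP => i; apply: xI.
by have := congr1 (ccoord i) st; rewrite !coord_cact.
Qed.

Lemma path_end_uniq (a : P) s : a (I1 R) = cact s x -> path_end a = s.
Proof. by rewrite path_endP => /cact_inj. Qed.

Lemma path_mulE (a b : P) (s : Aut) : a (I1 R) = cact s x ->
  path_mul a b = concat a (cact s \o b) :> (I -> F).
Proof. by move=> /path_end_uniq <-. Qed.

Lemma path_end_mul (a b : P) :
  path_end (path_mul a b) = (path_end a * path_end b)%g.
Proof. by apply: path_end_uniq; exact: path_mul1. Qed.

Lemma path_end_inv (a : P) : path_end (path_inv a) = (path_end a)^-1%g.
Proof. by apply: path_end_uniq; exact: path_inv1. Qed.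

Lemma path_end_one : path_end path_one = 1%g.
Proof. by apply: path_end_uniq; rewrite cact1. Qed.

(* The group laws hold up to any relation that contains reparametrization. *)
Section GroupLaws.
Variable E : P -> P -> Prop.
Hypothesis E_reparam : forall (a b : P) (p : I -> F) (f g : I -> I),
  continuous p -> continuous f -> continuous g ->
  f (I0 R) = g (I0 R) -> f (I1 R) = g (I1 R) ->
  (forall s, a s = p (f s)) -> (forall s, b s = p (g s)) -> E a b.

Lemma path_mul1g (a : P) : E (path_mul path_one a) a.
Proof.
apply: (@E_reparam _ _ a (fun s => clamp (2 * set_val s - 1)) id).
- exact: path_cont.
- by apply: affine_continuous; exact: val_continuous.
- by move=> s; exact: cvg_id.
- by rewrite val_I0 mulr0 clamp_le0// lerBlDr add0r ler01.
- by rewrite val_I1 mulr1 (natrD _ 1 1) addrK.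
- move=> s; rewrite (@path_mulE _ _ 1%g) ?cact1// /concat /= cact1.
  case: (leP (set_val s) 2^-1) => // hs.
  by rewrite [in RHS]clamp_le0 ?path_start; last by lra.
- by [].
Qed.

Lemma path_mulg1 (a : P) : E (path_mul a path_one) a.
Proof.
apply: (@E_reparam _ _ a (fun s => clamp (2 * set_val s + 0)) id).
- exact: path_cont.
- by apply: affine_continuous; exact: val_continuous.
- by move=> s; exact: cvg_id.
- by rewrite val_I0 mulr0 addr0.
- by rewrite val_I1 mulr1 addr0 clamp_ge1// ler1n.
- move=> s; rewrite (path_mulE _ (path_endP a)) /concat /= addr0.
  case: (leP (set_val s) 2^-1) => // hs.
  by rewrite [in RHS]clamp_ge1 ?path_endP; last by lra.
- by [].
Qed.

Let dist_cont : continuous (fun r : R => `|2 * r - 1|).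
Proof.
move=> r; apply: (@continuous_comp _ _ _ (fun r : R => 2 * r - 1)
  (fun r : R => `|r|)); last exact: (@norm_continuous R R^o).
apply: cvgB; last exact: cvg_cst.
by apply: cvgM; [exact: cvg_cst | exact: cvg_id].
Qed.

Let par_cont (u : R -> R) :
  continuous u -> continuous (fun s : I => clamp (u (set_val s))).
Proof.
move=> cu s; apply: (@continuous_comp _ _ _ _ (fun r => clamp (u r))).
  exact: val_continuous.
by apply: continuous_comp; [exact: cu | exact: clamp_continuous].
Qed.

Lemma path_mulVg (a : P) : E (path_mul (path_inv a) a) path_one.
Proof.
apply: (@E_reparam _ _ (cact (path_end a)^-1%g \o a)
  (fun s => clamp `|2 * set_val s - 1|) (fun=> I1 R)).
- move=> s; apply: continuous_comp; first exact: path_cont.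
  exact: cact_continuous.
- exact: par_cont dist_cont.
- exact: cst_continuous.
- by rewrite val_I0 mulr0 sub0r normrN1.
- by rewrite val_I1 mulr1 (natrD _ 1 1) addrK normr1.
- move=> s; rewrite (@path_mulE (path_inv a) a _ (path_inv1 a)) /concat /=.
  have /andP[s0 s1] := unit_itvP s.
  case: (leP (set_val s) 2^-1) => hs; congr (cact _ (path_fun a _)).
    rewrite /rev_itv clampE; last by lra.
    by rewrite ler0_norm ?opprB//; lra.
  by rewrite ger0_norm//; lra.
- by move=> s /=; rewrite path_endP -cactM mulVg cact1.
Qed.

Lemma path_mulgV (a : P) : E (path_mul a (path_inv a)) path_one.
Proof.
apply: (@E_reparam _ _ a
  (fun s => clamp (1 - `|2 * set_val s - 1|)) (fun=> I0 R)).
- exact: path_cont.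
- apply: (@par_cont (fun r => 1 - `|2 * r - 1|)) => r.
  by apply: cvgB; [exact: cvg_cst | exact: dist_cont].
- exact: cst_continuous.
- by rewrite val_I0 mulr0 sub0r normrN1 subrr.
- by rewrite val_I1 mulr1 (natrD _ 1 1) addrK normr1 subrr.
- move=> s; rewrite (path_mulE _ (path_endP a)) /concat /=.
  have /andP[s0 s1] := unit_itvP s.
  case: (leP (set_val s) 2^-1) => hs.
    congr (path_fun a (clamp _)).
    by rewrite ler0_norm; lra.
  rewrite -cactM mulgV cact1 /rev_itv.
  rewrite clampE; last by lra.
  by congr (path_fun a (clamp _)); rewrite ger0_norm//; lra.
- by move=> s /=; rewrite path_start.
Qed.

(* Reparametrization of (a o b) o c into a o (b o c). *)
Let assoc_par (r : R) : R :=
  Num.min (2 * r) (Num.min (r + 4^-1) (2^-1 * r + 2^-1)).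

Let assoc_par_lo r : r <= 4^-1 -> assoc_par r = 2 * r.
Proof. by move=> h; apply/min_idPl; rewrite le_min; apply/andP; split; lra. Qed.

Let assoc_par_mid r : 4^-1 <= r <= 2^-1 -> assoc_par r = r + 4^-1.
Proof.
move=> h; rewrite /assoc_par [X in Num.min _ X](min_idPl _); last by lra.
by apply/min_idPr; lra.
Qed.

Let assoc_par_hi r : 2^-1 <= r -> assoc_par r = 2^-1 * r + 2^-1.
Proof.
move=> h; rewrite /assoc_par [X in Num.min _ X](min_idPr _); last by lra.
by apply/min_idPr; lra.
Qed.

Let assoc_par_cont : continuous assoc_par.
Proof.
move=> r; apply: (@continuous_min R R (fun r => 2 * r)).
  by apply: cvgM; [exact: cvg_cst | exact: cvg_id].
apply: (@continuous_min R R (fun r => r + 4^-1)).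
  by apply: cvgD; [exact: cvg_id | exact: cvg_cst].
apply: cvgD; last exact: cvg_cst.
by apply: cvgM; [exact: cvg_cst | exact: cvg_id].
Qed.

Lemma path_mulA (a b c : P) :
  E (path_mul (path_mul a b) c) (path_mul a (path_mul b c)).
Proof.
apply: (@E_reparam _ _ (path_mul a (path_mul b c))
  (fun s => clamp (assoc_par (set_val s))) id).
- exact: path_cont.
- exact: par_cont assoc_par_cont.
- by move=> s; exact: cvg_id.
- by congr clamp; rewrite val_I0 assoc_par_lo; lra.
- by congr clamp; rewrite val_I1 assoc_par_hi; lra.
- move=> s.
  rewrite (path_mulE _ (path_endP (path_mul a b))) path_end_mul.
  rewrite (path_mulE (path_mul b c) (path_endP a)).
  have := unit_itvP s; rewrite /concat.
  move: (set_val s) => r /andP[r0 r1].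
  case: (leP r 2^-1) => hr.
    rewrite (path_mulE _ (path_endP a)) /concat.
    rewrite [set_val (clamp (2 * r))]clampE; last by lra.
    case: (leP (2 * r) 2^-1) => hr'.
      rewrite assoc_par_lo; last by lra.
      by rewrite clampE ?hr'; last by lra.
    rewrite assoc_par_mid; last by lra.
    rewrite [set_val (clamp (r + 4^-1))]clampE; last by lra.
    rewrite ifF; last by apply/negbTE; lra.
    rewrite /= /concat clampE; last by lra.
    rewrite ifT; last by lra.
    by congr (cact _ (path_fun b (clamp _))); lra.
  rewrite assoc_par_hi; last by lra.
  rewrite [set_val (clamp (2^-1 * r + _))]clampE; last by lra.
  rewrite ifF; last by apply/negbTE; lra.
  rewrite /= /concat clampE; last by lra.
  rewrite ifF; last by apply/negbTE; lra.
  rewrite /= cactM.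
  by congr (cact _ (cact _ (path_fun c (clamp _)))); lra.
- by [].
Qed.

End GroupLaws.

End OrbitPaths.

Section BraidGroups.
Variables (R : realType) (X : topologicalType) (n : nat) (G : sgraph n).
Variable x : config X G.
Local Notation I := (set_type (unit_itv R)).
Local Notation F := (set_type (config X G)).
Local Notation P := (@orbit_path R X n G x).

Definition homotopic (a b : P) : bool :=
  `[< exists H : I * I -> F, homotopy_rel a b H >].

Lemma homotopic_refl : reflexive homotopic.
Proof.
move=> a; apply/asboolP; eexists; apply: homotopy_rel_refl; exact: path_cont.
Qed.

Lemma homotopic_sym : symmetric homotopic.
Proof.
move=> a b; apply/asboolP/asboolP => -[H hH];
  by eexists; exact: homotopy_rel_sym hH.
Qed.

Lemma homotopic_trans : transitive homotopic.
Proof.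
move=> b a c /asboolP[H hH] /asboolP[K hK]; apply/asboolP.
by eexists; exact: homotopy_rel_trans hH hK.
Qed.

Canonical homotopic_equiv :=
  EquivRel homotopic homotopic_refl homotopic_sym homotopic_trans.

Lemma homotopy_rel_comp (T U : topologicalType) (f : T -> U) (a b : I -> T) H :
  continuous f -> homotopy_rel a b H ->
  homotopy_rel (f \o a) (f \o b) (f \o H).
Proof.
move=> cf [cH Ha Hb H0 H1]; split=> /=.
- by move=> z; apply: continuous_comp; [exact: cH | exact: cf].
- by move=> s; rewrite Ha.
- by move=> s; rewrite Hb.
- by move=> t; have [ha hb] := H0 t; split; [rewrite ha | rewrite hb].
- by move=> t; have [ha hb] := H1 t; split; [rewrite ha | rewrite hb].
Qed.

(* The string c(a) of a path a in X, and the unordered collection c(a) of the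
   strings of a path a in F(X,G). *)
Definition string (a : I -> X) : set (X * I) := [set (a s, s) | s in setT].

Definition strings (a : I -> F) : set (set (X * I)) :=
  [set string (ccoord i \o a) | i in setT].

Definition braids : set (set (set (X * I))) :=
  [set strings a | a in [set: P]].

Lemma braid_of_subproof (a : P) : strings a \in braids.
Proof. by apply/mem_set; exists a. Qed.

Definition braid_of (a : P) : braids :=
  exist (fun C => C \in braids) (strings a) (braid_of_subproof a).

(* The n maps h^_i (s, t) = (h_i (s, t), s) relating c(a) to c(b); crossings
   are forbidden between the strings j and k only if j and k are adjacent. *)
Definition crossing_homotopy (a b : I -> F) (h : 'I_n -> I * I -> X) : Prop :=
  [/\ forall i, continuous (fun z : I * I => (h i z, z.1)),
      forall i s, h i (s, I0 R) = ccoord i (a s) /\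
                  h i (s, I1 R) = ccoord i (b s),
      forall i t, h i (I0 R, t) = ccoord i (a (I0 R)) /\
                  h i (I0 R, t) = ccoord i (b (I0 R)),
      forall i t, h i (I1 R, t) = ccoord i (a (I1 R)) /\
                  h i (I1 R, t) = ccoord i (b (I1 R)) &
      forall z j k, G j k -> h j z <> h k z].

Definition crossing_equiv (a b : P) : Prop :=
  exists h, crossing_homotopy a b h.

Definition braid_equiv (C D : braids) : bool :=
  `[< exists a b : P,
        [/\ C = braid_of a, D = braid_of b & crossing_equiv a b] >].

Lemma crossing_homotopyP (a b : I -> F) h :
  crossing_homotopy a b h <->
  (forall i, homotopy_rel (ccoord i \o a) (ccoord i \o b) (h i)) /\
  (forall z j k, G j k -> h j z <> h k z).
Proof.
split=> [[ch h1 h2 h3 h4] | [hh h4]].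
  split=> // i; split; [|move=> s; have [] := h1 i s => //..|exact: h2|exact: h3].
  move=> z; apply: (@continuous_comp _ _ _ (fun z : I * I => (h i z, z.1)) fst).
    exact: ch.
  exact: cvg_fst.
split=> //.
- move=> i; have [ch _ _ _ _] := hh i; apply: pair_continuous => // z.
  exact: cvg_fst.
- by move=> i s; have [_ h1 h2 _ _] := hh i; split; [exact: h1 | exact: h2].
- by move=> i t; have [_ _ _ h1 _] := hh i; exact: h1.
- by move=> i t; have [_ _ _ _ h1] := hh i; exact: h1.
Qed.

Lemma crossing_equiv_refl a : crossing_equiv a a.
Proof.
exists (fun i => (ccoord i \o a) \o fst); apply/crossing_homotopyP; split.
  move=> i; apply: homotopy_rel_refl => s.
  by apply: continuous_comp; [exact: path_cont | exact: coord_continuous].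
by move=> z j k; exact: coordP.
Qed.

Lemma crossing_equiv_sym a b : crossing_equiv a b -> crossing_equiv b a.
Proof.
move=> [h /crossing_homotopyP[hh hG]].
exists (fun i z => h i (z.1, rev_itv z.2)); apply/crossing_homotopyP.
by split=> [i | z j k]; [exact: homotopy_rel_sym | exact: hG].
Qed.

Lemma crossing_equiv_trans a b c :
  crossing_equiv a b -> crossing_equiv b c -> crossing_equiv a c.
Proof.
move=> [h /crossing_homotopyP[hh hG]] [k /crossing_homotopyP[hk kG]].
exists (fun i => vpaste (h i) (k i)); apply/crossing_homotopyP.
split=> [i | z j l Gjl]; first exact: homotopy_rel_trans (hh i) (hk i).
by rewrite /vpaste /concat; case: ifP => _; [exact: hG | exact: kG].
Qed.

Lemma crossing_equiv_mul a a' b b' : path_end a = path_end a' ->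
  crossing_equiv a a' -> crossing_equiv b b' ->
  crossing_equiv (path_mul a b) (path_mul a' b').
Proof.
move=> ea [h /crossing_homotopyP[hh hG]] [k /crossing_homotopyP[hk kG]].
exists (fun i => hpaste (h i) (k (sgval (path_end a) i))).
apply/crossing_homotopyP; split=> [i | z j l Gjl].
  have coord_mul (c d : P) : ccoord i \o path_mul c d =
      concat (ccoord i \o c) (ccoord (sgval (path_end c) i) \o d).
    by apply/funext => s /=; rewrite /concat /=; case: ifP.
  have e : ccoord i (a (I1 R)) = ccoord (sgval (path_end a) i) (b (I0 R)).
    by rewrite path_endP path_start.
  by rewrite !coord_mul -ea; apply: homotopy_rel_concat.
rewrite /hpaste /concat; case: ifP => _; first exact: hG.
apply: kG; have /graph_autP -> // := subgP (path_end a).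
Qed.

Lemma crossing_equiv_reparam (a b : P) (p : I -> F) (f g : I -> I) :
  continuous p -> continuous f -> continuous g ->
  f (I0 R) = g (I0 R) -> f (I1 R) = g (I1 R) ->
  (forall s, a s = p (f s)) -> (forall s, b s = p (g s)) ->
  crossing_equiv a b.
Proof.
move=> cp cf cg e0 e1 ap bp.
exists (fun i => (ccoord i \o p) \o interp f g); apply/crossing_homotopyP.
split=> [i | z j k]; last exact: coordP.
have -> : ccoord i \o a = (ccoord i \o p) \o f.
  by apply/funext => s /=; rewrite ap.
have -> : ccoord i \o b = (ccoord i \o p) \o g.
  by apply/funext => s /=; rewrite bp.
apply: homotopy_rel_reparam => // s.
by apply: continuous_comp; [exact: cp | exact: coord_continuous].
Qed.

Lemma homotopic_mul a a' b b' : path_end a = path_end a' ->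
  homotopic a a' -> homotopic b b' ->
  homotopic (path_mul a b) (path_mul a' b').
Proof.
move=> ea /asboolP[H hH] /asboolP[K hK]; apply/asboolP.
exists (hpaste H (cact (path_end a) \o K)).
have e : a (I1 R) = cact (path_end a) (b (I0 R)).
  by rewrite path_endP path_start.
rewrite /path_mul /path_fun /= -ea; apply: homotopy_rel_concat => //.
by apply: homotopy_rel_comp => //; exact: cact_continuous.
Qed.

Lemma homotopic_reparam (a b : P) (p : I -> F) (f g : I -> I) :
  continuous p -> continuous f -> continuous g ->
  f (I0 R) = g (I0 R) -> f (I1 R) = g (I1 R) ->
  (forall s, a s = p (f s)) -> (forall s, b s = p (g s)) ->
  homotopic a b.
Proof.
move=> cp cf cg e0 e1 ap bp; apply/asboolP; exists (p \o interp f g).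
have -> : path_fun a = p \o f by apply/funext => s /=; rewrite ap.
have -> : path_fun b = p \o g by apply/funext => s /=; rewrite bp.
exact: homotopy_rel_reparam.
Qed.

Lemma homotopic_end a b : homotopic a b -> a (I1 R) = b (I1 R).
Proof.
by move=> /asboolP[H [_ _ _ _ /(_ (I0 R))[ha hb]]]; exact: etrans (esym ha) hb.
Qed.

Lemma crossing_equiv_end a b : crossing_equiv a b -> a (I1 R) = b (I1 R).
Proof.
move=> [h [_ _ _ h1 _]]; apply: config_eqP => i.
by have [ha hb] := h1 i (I0 R); exact: etrans (esym ha) hb.
Qed.

Hypothesis xI : injective (fun i => ccoord i x).

Lemma path_end_eq (a b : P) : a (I1 R) = b (I1 R) -> path_end a = path_end b.
Proof. by move=> ab; apply: (path_end_uniq xI); rewrite ab path_endP. Qed.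

(* The strings start at the distinct points x_i, so that the unordered
   collection of strings determines the path. *)
Lemma braid_of_inj : injective braid_of.
Proof.
move=> a b /(congr1 val) /= ab.
apply: orbit_path_inj; apply/funext => s; apply: config_eqP => i.
have : strings b (string (ccoord i \o a)) by rewrite -ab; exists i.
move=> [j _ ji].
have mem t : string (ccoord j \o b) (ccoord i (a t), t) by rewrite ji; exists t.
have eqs t : ccoord j (b t) = ccoord i (a t).
  by have [u _ /pair_equal_spec[<- ->]] := mem t.
have := eqs (I0 R); rewrite !path_start => /xI ij.
by rewrite -eqs ij.
Qed.

Lemma braid_ofP (C : braids) : exists a : P, braid_of a = C.
Proof.
by case: C => C hC; have [a _ aC] := set_mem hC; exists a; exact: val_inj.
Qed.

Definition strands (C : braids) : P := projT1 (cid (braid_ofP C)).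

Lemma strandsK : cancel strands braid_of.
Proof. by move=> C; exact: projT2 (cid (braid_ofP C)). Qed.

Lemma braid_ofK : cancel braid_of strands.
Proof. by move=> a; apply: braid_of_inj; rewrite strandsK. Qed.

Lemma braid_equivE a b :
  braid_equiv (braid_of a) (braid_of b) <-> crossing_equiv a b.
Proof.
split=> [/asboolP[a' [b' [/braid_of_inj -> /braid_of_inj ->]]] // | ab].
by apply/asboolP; exists a, b.
Qed.

Lemma braid_equiv_refl : reflexive braid_equiv.
Proof.
move=> C; rewrite -[C]strandsK; apply/braid_equivE.
exact: crossing_equiv_refl.
Qed.

Lemma braid_equiv_sym : symmetric braid_equiv.
Proof.
move=> C D; rewrite -[C]strandsK -[D]strandsK.
by apply/idP/idP => /braid_equivE h; apply/braid_equivE;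
  exact: crossing_equiv_sym.
Qed.

Lemma braid_equiv_trans : transitive braid_equiv.
Proof.
move=> D C E; rewrite -[C]strandsK -[D]strandsK -[E]strandsK.
move=> /braid_equivE h /braid_equivE k; apply/braid_equivE.
exact: crossing_equiv_trans h k.
Qed.

Definition braid_equiv_rel :=
  EquivRel braid_equiv braid_equiv_refl braid_equiv_sym braid_equiv_trans.

(* The extended fundamental group of (F(X,G), x, Aut(G)(x)).  The type carries
   xI because the group law below depends on it. *)
Definition ext_pi1 : Type := let _ := xI in {eq_quot homotopic_equiv}.

HB.instance Definition _ := Choice.on ext_pi1.

Definition pi1_class (a : P) : ext_pi1 := \pi_{eq_quot homotopic_equiv} a.

Lemma pi1_classP a b : pi1_class a = pi1_class b <-> homotopic a b.
Proof. by split=> /eqmodP. Qed.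

Lemma pi1_class_surj (u : ext_pi1) : exists a, pi1_class a = u.
Proof. by exists (repr (u : {eq_quot homotopic_equiv})); exact: reprK. Qed.

Definition pi1_repr (u : ext_pi1) : P := projT1 (cid (pi1_class_surj u)).

Lemma pi1_reprK : cancel pi1_repr pi1_class.
Proof. by move=> u; exact: projT2 (cid (pi1_class_surj u)). Qed.

Definition pi1_mul (u v : ext_pi1) : ext_pi1 :=
  pi1_class (path_mul (pi1_repr u) (pi1_repr v)).

Definition pi1_one : ext_pi1 := pi1_class (path_one R x).

Definition pi1_inv (u : ext_pi1) : ext_pi1 := pi1_class (path_inv (pi1_repr u)).

Lemma pi1_mulE a b :
  pi1_mul (pi1_class a) (pi1_class b) = pi1_class (path_mul a b).
Proof.
have ha : homotopic (pi1_repr (pi1_class a)) a.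
  by apply/pi1_classP; rewrite pi1_reprK.
have hb : homotopic (pi1_repr (pi1_class b)) b.
  by apply/pi1_classP; rewrite pi1_reprK.
apply/pi1_classP; apply: homotopic_mul => //.
by apply: path_end_eq; exact: homotopic_end.
Qed.

Lemma pi1_mulA : associative pi1_mul.
Proof.
move=> u v w; rewrite -[u]pi1_reprK -[v]pi1_reprK -[w]pi1_reprK !pi1_mulE.
apply/esym/pi1_classP.
exact: (@path_mulA _ _ _ _ _ xI homotopic homotopic_reparam).
Qed.

Lemma pi1_mul1g : left_id pi1_one pi1_mul.
Proof.
move=> u; rewrite -[u]pi1_reprK pi1_mulE; apply/pi1_classP.
exact: (@path_mul1g _ _ _ _ _ xI homotopic homotopic_reparam).
Qed.

Lemma pi1_mulg1 : right_id pi1_one pi1_mul.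
Proof.
move=> u; rewrite -[u]pi1_reprK pi1_mulE; apply/pi1_classP.
exact: (@path_mulg1 _ _ _ _ _ xI homotopic homotopic_reparam).
Qed.

Lemma pi1_mulVg : left_inverse pi1_one pi1_inv pi1_mul.
Proof.
move=> u; rewrite -[X in pi1_mul _ X]pi1_reprK pi1_mulE; apply/pi1_classP.
exact: (@path_mulVg _ _ _ _ _ xI homotopic homotopic_reparam).
Qed.

Lemma pi1_mulgV : right_inverse pi1_one pi1_inv pi1_mul.
Proof.
move=> u; rewrite -[X in pi1_mul X _]pi1_reprK pi1_mulE; apply/pi1_classP.
exact: (@path_mulgV _ _ _ _ _ xI homotopic homotopic_reparam).
Qed.

HB.instance Definition _ := isGroup.Build ext_pi1
  pi1_mulA pi1_mul1g pi1_mulg1 pi1_mulVg pi1_mulgV.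

(* The crossing-changeable braid group B(X,G). *)
Definition braid_group : Type := {eq_quot braid_equiv_rel}.

HB.instance Definition _ := Choice.on braid_group.

Definition braid_class (C : braids) : braid_group :=
  \pi_{eq_quot braid_equiv_rel} C.

Lemma braid_classP a b :
  braid_class (braid_of a) = braid_class (braid_of b) <-> crossing_equiv a b.
Proof.
split=> [/eqmodP/braid_equivE // | /braid_equivE h].
exact/(@eqmodP _ braid_equiv_rel).
Qed.

Lemma braid_class_surj (u : braid_group) :
  exists a, braid_class (braid_of a) = u.
Proof.
exists (strands (repr (u : {eq_quot braid_equiv_rel}))); rewrite strandsK.
exact: reprK.
Qed.

Definition braid_repr (u : braid_group) : P := projT1 (cid (braid_class_surj u)).

Lemma braid_reprK : cancel braid_repr (braid_class \o braid_of).
Proof. by move=> u; exact: projT2 (cid (braid_class_surj u)). Qed.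

Definition braid_mul (u v : braid_group) : braid_group :=
  braid_class (braid_of (path_mul (braid_repr u) (braid_repr v))).

Definition braid_one : braid_group := braid_class (braid_of (path_one R x)).

Definition braid_inv (u : braid_group) : braid_group :=
  braid_class (braid_of (path_inv (braid_repr u))).

Lemma braid_mulE a b :
  braid_mul (braid_class (braid_of a)) (braid_class (braid_of b)) =
  braid_class (braid_of (path_mul a b)).
Proof.
set u := braid_class (braid_of a); set v := braid_class (braid_of b).
have ha : crossing_equiv (braid_repr u) a.
  by apply/braid_classP; exact: braid_reprK.
have hb : crossing_equiv (braid_repr v) b.
  by apply/braid_classP; exact: braid_reprK.
apply/braid_classP; apply: crossing_equiv_mul => //.
by apply: path_end_eq; exact: crossing_equiv_end.
Qed.

Lemma braid_mulA : associative braid_mul.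
Proof.
move=> u v w; rewrite -[u]braid_reprK -[v]braid_reprK -[w]braid_reprK.
rewrite /= !braid_mulE; apply/esym/braid_classP.
exact: (@path_mulA _ _ _ _ _ xI crossing_equiv crossing_equiv_reparam).
Qed.

Lemma braid_mul1g : left_id braid_one braid_mul.
Proof.
move=> u; rewrite -[u]braid_reprK /= braid_mulE; apply/braid_classP.
exact: (@path_mul1g _ _ _ _ _ xI crossing_equiv crossing_equiv_reparam).
Qed.

Lemma braid_mulg1 : right_id braid_one braid_mul.
Proof.
move=> u; rewrite -[u]braid_reprK /= braid_mulE; apply/braid_classP.
exact: (@path_mulg1 _ _ _ _ _ xI crossing_equiv crossing_equiv_reparam).
Qed.

Lemma braid_mulVg : left_inverse braid_one braid_inv braid_mul.
Proof.
move=> u; rewrite -[X in braid_mul _ X]braid_reprK /= braid_mulE.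
apply/braid_classP.
exact: (@path_mulVg _ _ _ _ _ xI crossing_equiv crossing_equiv_reparam).
Qed.

Lemma braid_mulgV : right_inverse braid_one braid_inv braid_mul.
Proof.
move=> u; rewrite -[X in braid_mul X _]braid_reprK /= braid_mulE.
apply/braid_classP.
exact: (@path_mulgV _ _ _ _ _ xI crossing_equiv crossing_equiv_reparam).
Qed.

HB.instance Definition _ := isGroup.Build braid_group
  braid_mulA braid_mul1g braid_mulg1 braid_mulVg braid_mulgV.

End BraidGroups.

Definition group_isomorphic (G H : groupType) : Prop :=
  exists2 f : G -> H, bijective f & {morph f : a b / (a * b)%g >-> (a * b)%g}.

Arguments ext_pi1 R {X n G x} xI.
Arguments braid_group R {X n G x} xI.

(* Main.v *)
Require Import Defs.
From HB Require Import structures.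
From mathcomp Require Import all_boot all_order all_algebra all_fingroup.
From mathcomp Require Import all_classical all_reals topology normedtype.

Set Implicit Arguments.
Unset Strict Implicit.
Unset Printing Implicit Defensive.

Local Open Scope classical_set_scope.

(** The strings of a path start at pairwise distinct points, so the unordered
collection of strings determines the path: sending the class of a path in
[ext_pi1] to the class of its braid is therefore meaningful in both directions,
once the two equivalence relations on paths are seen to coincide.

They do, by the universal properties of products and subspaces.  A family of
[n] maps [h i] from the square to [X] with [h j z <> h k z] along every edge
[jk] is the same thing as a map from the square to the configuration space,
continuous if and only if each [h i] is, and the boundary conditions correspond
coordinate by coordinate.  So [crossing_equiv] is [homotopic]
([crossing_equivE]).  Both group laws are induced by [path_mul] on
representatives, so the resulting bijection is a morphism. *)

Section BraidsAsHomotopyClasses.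
Variables (R : realType) (X : topologicalType) (n : nat) (G : sgraph n).
Variable x : config X G.
Implicit Types a b : @orbit_path R X n G x.

Lemma homotopic_crossing a b : homotopic a b -> crossing_equiv a b.
Proof.
move=> /asboolP[H hH]; exists (fun i => ccoord i \o H).
apply/crossing_homotopyP; split=> [i | z j k]; last exact: coordP.
by apply: homotopy_rel_comp hH; exact: Defs.coord_continuous.
Qed.

Lemma crossing_homotopic a b : crossing_equiv a b -> homotopic a b.
Proof.
move=> [h /crossing_homotopyP[hh hG]]; apply/asboolP.
exists (fun z => mk_config (hG z)); split.
- by apply: config_continuous => i; have [] := hh i.
- by move=> s; apply: config_eqP => i; have [_ ha _ _ _] := hh i; exact: ha.
- by move=> s; apply: config_eqP => i; have [_ _ hb _ _] := hh i; exact: hb.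
- by move=> t; split; apply: config_eqP => i; have [_ _ _ /(_ t)[ha hb] _] := hh i.
- by move=> t; split; apply: config_eqP => i; have [_ _ _ _ /(_ t)[ha hb]] := hh i.
Qed.

Lemma crossing_equivE a b : crossing_equiv a b <-> homotopic a b.
Proof. by split; [exact: crossing_homotopic | exact: homotopic_crossing]. Qed.

Hypothesis xI : injective (fun i : 'I_n => ccoord i x).

(** The class in the extended fundamental group of a path whose strings form a
braid of the given class.  It does not depend on the chosen representative, by
[braid_to_pi1E]. *)
Definition braid_to_pi1 (u : braid_group R xI) : ext_pi1 R xI :=
  pi1_class xI (braid_repr u).

(** The class of the braid formed by the strings of a chosen representative. *)
Definition pi1_to_braid (v : ext_pi1 R xI) : braid_group R xI :=
  braid_class xI (braid_of (pi1_repr v)).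

Lemma braid_to_pi1E a :
  braid_to_pi1 (braid_class xI (braid_of a)) = pi1_class xI a.
Proof.
apply/pi1_classP/crossing_equivE/(braid_classP xI).
exact: (braid_reprK (braid_class xI (braid_of a))).
Qed.

Lemma braid_to_pi1K : cancel braid_to_pi1 pi1_to_braid.
Proof.
move=> u; rewrite -[RHS]braid_reprK /=.
by apply/braid_classP/crossing_equivE/(pi1_classP xI); rewrite pi1_reprK.
Qed.

Lemma pi1_to_braidK : cancel pi1_to_braid braid_to_pi1.
Proof. by move=> v; rewrite braid_to_pi1E pi1_reprK. Qed.

Lemma braid_to_pi1M : {morph braid_to_pi1 : u v / (u * v)%g >-> (u * v)%g}.
Proof. by move=> u v; rewrite [LHS]braid_to_pi1E; exact/esym/pi1_mulE. Qed.

End BraidsAsHomotopyClasses.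

Theorem theorem1p1 (R : realType) (X : topologicalType) (d : nat)
    (X_manifold : topological_manifold R d X) (d_ge2 : (2 <= d)%N)
    (X_connected : connected [set: X])
    (n : nat) (G : sgraph n) (x : config X G)
    (x_distinct : injective (fun i : 'I_n => ccoord i x)) :
  group_isomorphic (braid_group R x_distinct) (ext_pi1 R x_distinct).
Proof.
exists (@braid_to_pi1 R X n G x x_distinct); last exact: braid_to_pi1M.
by exists (@pi1_to_braid R X n G x x_distinct);
  [exact: braid_to_pi1K | exact: pi1_to_braidK].
Qed.
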